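(* Let $R$ be an associative ring with $1$ and let $\mathcal K\subseteq \mathrm{Mod}\text{-}R$ and $\mathcal L\subseteq R\text{-}\mathrm{Mod}$ be definably dual classes of modules. Then every countable subset of a $\mathcal K$-Mittag-Leffler left $R$-module $M$ is contained in a countably generated $\mathcal L$-pure submodule of $M$ that is $\mathcal K$-Mittag-Leffler.
   Context: A pp formula over left $R$-modules is $\varphi(\bar x)=\exists\bar y\,(A\bar x=B\bar y)$ with $A,B$ matrices over $R$; $\varphi(M)$ is its solution set in $M$. For a class $\mathcal X$ of modules, $\varphi\le_{\mathcal X}\psi$ means $\varphi(X)\subseteq\psi(X)$ for all $X\in\mathcal X$. $\langle\mathcal X\rangle$ is the definable subcategory generated by $\mathcal X$: the class of all modules $C$ such that $\varphi\le_{\mathcal X}\psi$ implies $\varphi(C)\subseteq\psi(C)$, for all pp $\varphi,\psi$. The elementary dual of $\varphi$ is the right pp formula $\mathrm D\varphi(\bar x)=\exists\bar z(\bar x=\bar zA\wedge \bar zB=0)$. Classes $\mathcal K$ of right and $\mathcal L$ of left $R$-modules are definably dual if, for all left pp formulas $\varphi,\psi$: $\varphi\le_{\mathcal L}\psi$ iff $\mathrm D\psi\le_{\mathcal K}\mathrm D\varphi$. A left module $M$ is $\mathcal K$-Mittag-Leffler if the canonical map $(\prod_I N_i)\otimes M\to\prod_I(N_i\otimes M)$ is injective for every family $(N_i)_{i\in I}$ of members of $\mathcal K$. A submodule $N$ of $M$ is $\mathcal L$-pure if $K\otimes N\to K\otimes M$ is injective for all $K\in\langle\mathcal K\rangle$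 ($\mathcal K$ definably dual to $\mathcal L$). *)

(* Defs.v *)
From HB Require Import structures.
From mathcomp Require Import all_boot all_order all_algebra.
From mathcomp Require Import boolp classical_sets functions cardinality.
From mathcomp Require Import freeg.

Set Implicit Arguments.
Unset Strict Implicit.
Unset Printing Implicit Defensive.

Import GRing.Theory.
Local Open Scope classical_set_scope.
Local Open Scope ring_scope.

(* Right R-modules are left modules over the converse ring R^c; for k in a
   right module and r : R, the product k r is (r : R^c) *: k. *)
Notation rmodType R := (lmodType R^c).

Section Tensor.
Variables (R : pzRingType) (K : rmodType R) (M : lmodType R).

Definition tensor_free : zmodType := {freeg (K * M)%type / int}.

Definition fpure (k : K) (m : M) : tensor_free := << (k, m) >>.

Inductive tensor_gen : tensor_free -> Prop :=
| TensorDl k k' m : tensor_gen (fpure (k + k') m - (fpure k m + fpure k' m))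
| TensorDr k m m' : tensor_gen (fpure k (m + m') - (fpure k m + fpure k m'))
| TensorZ k (r : R) m :
    tensor_gen (fpure ((r : R^c) *: k) m - fpure k (r *: m)).

Definition tensor_rel : {pred tensor_free} := fun x =>
  `[< forall S : {pred tensor_free}, zmod_closed S ->
        (forall y, tensor_gen y -> y \in S) -> x \in S >].

Lemma tensor_rel_zmod : zmod_closed tensor_rel.
Proof.
split=> [|x y /asboolP xT /asboolP yT]; apply/asboolP => S S_zmod genS.
  by case: S_zmod.
by case: (S_zmod) => _ SB; apply: SB; [apply: xT | apply: yT].
Qed.

HB.instance Definition _ :=
  GRing.isZmodClosed.Build tensor_free tensor_rel tensor_rel_zmod.

Definition tensor : zmodType := {ideal_quot tensor_rel}.

Definition tens (k : K) (m : M) : tensor :=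
  \pi_({ideal_quot tensor_rel})%qT (fpure k m).

Definition balanced (A : zmodType) (f : K -> M -> A) : Prop :=
  [/\ forall k k' m, f (k + k') m = f k m + f k' m,
      forall k m m', f k (m + m') = f k m + f k m' &
      forall k (r : R) m, f ((r : R^c) *: k) m = f k (r *: m)].

(* The homomorphism sending tens k m to f k m; meaningful only for balanced f. *)
Definition tensor_lift (A : zmodType) (f : K -> M -> A) (t : tensor) : A :=
  fglift (fun km : K * M => f km.1 km.2 : zmodule A)
         (repr (t : {ideal_quot tensor_rel})).

Lemma tens_balanced : balanced tens.
Proof.
have gen_pi x y : tensor_gen (x - y) ->
    \pi_({ideal_quot tensor_rel})%qT x = \pi_({ideal_quot tensor_rel})%qT y.
  move=> xy; apply/eqP; rewrite -Quotient.idealrBE; apply/asboolP => S _.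
  exact.
split=> *; rewrite /tens.
- by rewrite (gen_pi _ _ (TensorDl _ _ _)) raddfD.
- by rewrite (gen_pi _ _ (TensorDr _ _ _)) raddfD.
- by rewrite (gen_pi _ _ (TensorZ _ _ _)).
Qed.

Section Lift.
Variables (A : zmodType) (f : K -> M -> A).
Hypothesis f_bal : balanced f.

Let g := fglift (fun km : K * M => f km.1 km.2 : zmodule A).

Let g_pure k m : g (fpure k m) = f k m.
Proof. by rewrite /g /fpure liftU scale1r. Qed.

Let gB : {morph g : x y / x - y}. Proof. exact: lift_is_additive. Qed.

Let g0 : g 0 = 0. Proof. by rewrite -(subrr 0) gB subrr. Qed.

Let gD : {morph g : x y / x + y}.
Proof. by move=> x y; rewrite -[y in LHS]opprK -[- y]sub0r !gB g0 sub0r opprK. Qed.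

Let g_rel x : x \in tensor_rel -> g x = 0.
Proof.
move=> /asboolP xT; apply/eqP.
apply: (xT [pred y | g y == 0]) => [|_ []]; rewrite ?inE.
- split=> [|y z]; rewrite !inE ?g0 // => /eqP y0 /eqP z0.
  by rewrite gB y0 z0 subr0.
- by move=> k k' m; rewrite inE gB gD !g_pure; case: f_bal => -> _ _; rewrite subrr.
- by move=> k m m'; rewrite inE gB gD !g_pure; case: f_bal => _ -> _; rewrite subrr.
- by move=> k r m; rewrite inE gB !g_pure; case: f_bal => _ _ ->; rewrite subrr.
Qed.

Let lift_pi x : tensor_lift f (\pi_({ideal_quot tensor_rel})%qT x) = g x.
Proof.
apply/eqP; rewrite -subr_eq0 -[tensor_lift f _]/(g _) -gB; apply/eqP/g_rel.
by rewrite Quotient.idealrBE reprK.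
Qed.

Lemma tensor_lift_tens k m : tensor_lift f (tens k m) = f k m.
Proof. by rewrite lift_pi g_pure. Qed.

Lemma tensor_liftB : {morph tensor_lift f : x y / x - y}.
Proof.
move=> x y; rewrite -[x](@reprK _ {ideal_quot tensor_rel}).
rewrite -[y](@reprK _ {ideal_quot tensor_rel}).
have <- := raddfB (\pi_({ideal_quot tensor_rel})%qT : tensor_free -> tensor).
by rewrite !lift_pi gB.
Qed.

End Lift.

Lemma tensorP (t : tensor) :
  exists s : seq (K * M), t = \sum_(km <- s) tens km.1 km.2.
Proof.
rewrite -[t](@reprK _ {ideal_quot tensor_rel}).
set P := fun t : tensor => exists s : seq (K * M), t = \sum_(km <- s) tens km.1 km.2.
have PD x y : P x -> P y -> P (x + y).
  by move=> [sx ->] [sy ->]; exists (sx ++ sy); rewrite big_cat.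
have [tDl _ _] := tens_balanced.
have tensN k m : tens (- k) m = - tens k m.
  apply/eqP; rewrite -addr_eq0 -tDl addNr -(addrK (tens 0 m) (tens 0 m)) -tDl.
  by rewrite addr0 subrr.
have PN x : P x -> P (- x).
  move=> [sx ->]; exists [seq (- km.1, km.2) | km <- sx].
  by rewrite big_map -sumrN; apply: eq_bigr => km _; rewrite tensN.
have P0 : P 0 by exists [::]; rewrite big_nil.
set x : tensor_free := repr _.
rewrite -[x]freeg_sumE raddf_sum; apply: (big_ind P) => // -[k m] _.
have Pn n : P (tens k m *+ n).
  elim: n => [|n IHn]; rewrite ?mulr0n // mulrS; apply: PD => //.
  by exists [:: (k, m)]; rewrite big_seq1.
rewrite -[coeff _ _]intz -freegU_mulz.
rewrite raddfMz -/(fpure k m) -/(tens k m).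
by case: (coeff (k, m) x : int) => n; [exact: Pn | rewrite NegzE mulrNz; exact/PN/Pn].
Qed.

End Tensor.

Section TensorMap.
Variables (R : pzRingType) (K K' : rmodType R) (M M' : lmodType R).
Variables (f : {linear K -> K'}) (g : {linear M -> M'}).

Definition tensor_map : tensor K M -> tensor K' M' :=
  tensor_lift (fun k m => tens (f k) (g m)).

Lemma tensor_map_balanced : balanced (fun k m => tens (f k) (g m)).
Proof.
have [tDl tDr tZ] := tens_balanced K' M'.
by split=> *; rewrite ?raddfD ?linearZ /= ?tDl ?tDr ?tZ.
Qed.

Lemma tensor_map_tens k m : tensor_map (tens k m) = tens (f k) (g m).
Proof. exact: (tensor_lift_tens tensor_map_balanced). Qed.

HB.instance Definition _ := GRing.isZmodMorphism.Build (tensor K M) (tensor K' M')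
  tensor_map (tensor_liftB tensor_map_balanced).

End TensorMap.

Section ProdMod.
Variables (R : pzRingType) (I : Type) (N : I -> lmodType R).

Definition prodmod : Type := forall i, N i.

HB.instance Definition _ := Choice.on prodmod.

Let add (x y : prodmod) : prodmod := fun i => x i + y i.
Let opp (x : prodmod) : prodmod := fun i => - x i.
Let zero : prodmod := fun i => 0.
Let scale (a : R) (x : prodmod) : prodmod := fun i => a *: x i.

Let addA : associative add.
Proof. by move=> x y z; apply: functional_extensionality_dep => i; exact: addrA. Qed.
Let addC : commutative add.
Proof. by move=> x y; apply: functional_extensionality_dep => i; exact: addrC. Qed.
Let add0 : left_id zero add.
Proof. by move=> x; apply: functional_extensionality_dep => i; exact: add0r. Qed.
Let addN : left_inverse zero opp add.
Proof. by move=> x; apply: functional_extensionality_dep => i; exact: addNr. Qed.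

HB.instance Definition _ := GRing.isZmodule.Build prodmod addA addC add0 addN.

Let scaleA a b x : scale a (scale b x) = scale (a * b) x.
Proof. by apply: functional_extensionality_dep => i; exact: scalerA. Qed.
Let scale1 : left_id 1 scale.
Proof. by move=> x; apply: functional_extensionality_dep => i; exact: scale1r. Qed.
Let scaleDr : right_distributive scale +%R.
Proof. by move=> a x y; apply: functional_extensionality_dep => i; exact: scalerDr. Qed.
Let scaleDl x : {morph scale^~ x : a b / a + b}.
Proof. by move=> a b; apply: functional_extensionality_dep => i; exact: scalerDl. Qed.

HB.instance Definition _ :=
  GRing.Zmodule_isLmodule.Build R prodmod scaleA scale1 scaleDr scaleDl.

Definition prodmod_proj (i : I) (x : prodmod) : N i := x i.

Let proj_linear i : linear (prodmod_proj i).
Proof. by []. Qed.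

HB.instance Definition _ i :=
  GRing.isLinear.Build R prodmod (N i) *:%R (prodmod_proj i) (proj_linear i).

End ProdMod.

Section SubMod.
Variables (R : pzRingType) (M : lmodType R) (S : submodClosed M).

Definition submod : Type := {x : M | x \in S}.

HB.instance Definition _ := SubChoice.on submod.
HB.instance Definition _ := [SubChoice_isSubLmodule of submod by <:].

End SubMod.

Definition lin_span (R : pzRingType) (M : lmodType R) (G : set M) : set M :=
  [set x | exists n (r : 'I_n -> R) (g : 'I_n -> M),
     (forall i, G (g i)) /\ x = \sum_i r i *: g i].

Definition countably_generated (R : pzRingType) (M : lmodType R)
    (S : submodClosed M) : Prop :=
  exists2 G : set M, countable G & [set` S] = lin_span G.

(* The formula exists y, A x = B y, with x of length n. *)
Record pp (R : pzRingType) (n : nat) := PP {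
  pp_neq : nat;
  pp_nex : nat;
  pp_A : 'M[R]_(pp_neq, n);
  pp_B : 'M[R]_(pp_neq, pp_nex) }.

Definition pp_sol (R : pzRingType) (n : nat) (phi : pp R n) (M : lmodType R) :
    set ('I_n -> M) :=
  [set x | exists y : 'I_(pp_nex phi) -> M, forall i,
     \sum_j pp_A phi i j *: x j = \sum_j pp_B phi i j *: y j].

Arguments pp_sol {R n} phi M _.

(* Right pp formulas over R are pp formulas over R^c.  The system
   x = z A, z B = 0 is x [1 0] = z [A B]; scalars being written on the left,
   its matrices are transposed. *)
Definition pp_dual (R : pzRingType) (n : nat) (phi : pp R n) : pp R^c n :=
  @PP R^c n (n + pp_nex phi) (pp_neq phi)
    (col_mx 1%:M 0) (row_mx (pp_A phi) (pp_B phi))^T.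

Lemma pp_dualE (R : pzRingType) n (phi : pp R n) (N : rmodType R) (x : 'I_n -> N) :
  pp_sol (pp_dual phi) N x <->
  exists z : 'I_(pp_neq phi) -> N,
    (forall j, x j = \sum_i (pp_A phi i j : R^c) *: z i) /\
    (forall j, 0 = \sum_i (pp_B phi i j : R^c) *: z i).
Proof.
split=> -[z zP]; exists z.
  split=> j.
    have := zP (lshift _ j); rewrite (bigD1 j) //= col_mxEu mxE eqxx scale1r.
    rewrite big1 ?addr0 => [->|k kj]; last by rewrite col_mxEu mxE eq_sym (negPf kj) scale0r.
    by apply: eq_bigr => i _; rewrite mxE row_mxEl.
  have := zP (rshift _ j); rewrite big1 => [zE|k _]; last by rewrite col_mxEd mxE scale0r.
  by apply: etrans zE _; apply: eq_bigr => i _; rewrite mxE row_mxEr.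
case: zP => xE zE; change 'I_(pp_neq (pp_dual phi)) with 'I_(n + pp_nex phi) => i.
case: (fintype.split_ordP i) => j -> /=.
  rewrite (bigD1 j) //= col_mxEu mxE eqxx scale1r big1 => [|k kj].
    by rewrite addr0; apply: etrans (xE j) _; apply: eq_bigr => k _; rewrite mxE row_mxEl.
  by rewrite col_mxEu mxE eq_sym (negPf kj) scale0r.
rewrite big1 => [|k _]; last by rewrite col_mxEd mxE scale0r.
by apply: etrans (zE j) _; apply: eq_bigr => k _; rewrite mxE row_mxEr.
Qed.

Definition pp_le (R : pzRingType) (X : lmodType R -> Prop) (n : nat)
    (phi psi : pp R n) : Prop :=
  forall M : lmodType R, X M -> pp_sol phi M `<=` pp_sol psi M.

Definition definable_closure (R : pzRingType) (X : lmodType R -> Prop)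
    (C : lmodType R) : Prop :=
  forall n (phi psi : pp R n), pp_le X phi psi -> pp_sol phi C `<=` pp_sol psi C.

Definition definably_dual (R : pzRingType) (K : rmodType R -> Prop)
    (L : lmodType R -> Prop) : Prop :=
  forall n (phi psi : pp R n),
    pp_le L phi psi <-> pp_le K (pp_dual psi) (pp_dual phi).

Definition tensor_prod_map (R : pzRingType) (I : Type) (N : I -> rmodType R)
    (M : lmodType R) (t : tensor (prodmod N) M) : forall i, tensor (N i) M :=
  fun i => tensor_map (@prodmod_proj _ I N i) idfun t.

Definition mittag_leffler (R : pzRingType) (K : rmodType R -> Prop)
    (M : lmodType R) : Prop :=
  forall (I : Type) (N : I -> rmodType R), (forall i, K (N i)) ->
    injective (@tensor_prod_map R I N M).

(* L-purity, where L is a class of left modules definably dual to K: it depends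
   on L only through the definable subcategory generated by K. *)
Definition dual_pure (R : pzRingType) (K : rmodType R -> Prop)
    (M : lmodType R) (S : submodClosed M) : Prop :=
  forall C : rmodType R, definable_closure K C ->
    injective (tensor_map (idfun : C -> C) (val : submod S -> M)).

(* Main.v *)
Require Import Defs.
From HB Require Import structures.
From mathcomp Require Import all_boot all_order all_algebra.
From mathcomp Require Import boolp classical_sets functions cardinality.
From mathcomp Require Import freeg.

Import GRing.Theory.
Local Open Scope classical_set_scope.
Local Open Scope ring_scope.

Set Implicit Arguments.
Unset Strict Implicit.
Unset Printing Implicit Defensive.

(* By Herzog's criterion, sum_i c_i (x) a_i = 0 in N (x) M iff some pp formula
   psi satisfies a \in psi(M) and c \in Dpsi(N).  Testing the Mittag-Leffler
   property on a product of counterexamples shows that every finite tuple a of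
   M has a formula phi_a in its pp type with Dpsi <=_K Dphi_a for all psi in
   that pp type.  Close X under witnesses of phi_a for all tuples a of the
   closure; the result G is countable.  If a relation between c and a tuple a of
   G holds in C (x) M, with C in <K>, then c \in Dpsi(C) <= Dphi_a(C) for some
   psi, and phi_a holds of a in the span S of G, so the relation already holds
   in C (x) S: thus S is pure.  As <K> is closed under products, purity lets S
   inherit the Mittag-Leffler property from M. *)

(** * Vanishing of tensors and pp formulas *)

Section TensSums.
Variables (R : pzRingType) (N : rmodType R) (M : lmodType R).

Let tDl : forall k k' m, @tens R N M (k + k') m = tens k m + tens k' m.
Proof. by case: (tens_balanced N M). Qed.

Let tDr : forall k m m', @tens R N M k (m + m') = tens k m + tens k m'.
Proof. by case: (tens_balanced N M). Qed.

Lemma tensZ k (r : R) m : @tens R N M ((r : R^c) *: k) m = tens k (r *: m).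
Proof. by case: (tens_balanced N M). Qed.

Lemma tens0l m : @tens R N M 0 m = 0.
Proof. by apply: (addrI (tens 0 m)); rewrite -tDl !addr0. Qed.

Lemma tens0r k : @tens R N M k 0 = 0.
Proof. by apply: (addrI (tens k 0)); rewrite -tDr !addr0. Qed.

Lemma tens_suml (I : Type) (s : seq I) (k : I -> N) m :
  @tens R N M (\sum_(i <- s) k i) m = \sum_(i <- s) tens (k i) m.
Proof. by apply: (big_morph (fun k => tens k m)) => [x y|]; rewrite ?tens0l. Qed.

Lemma tens_sumr (I : Type) (s : seq I) k (m : I -> M) :
  @tens R N M k (\sum_(i <- s) m i) = \sum_(i <- s) tens k (m i).
Proof. by apply: (big_morph (tens k)) => [x y|]; rewrite ?tens0r. Qed.

(** With [c = zA] and [zB = 0], moving scalars across the tensor sign turns the sum into the pairing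
    of [z] with [Aa = By], hence of [zB = 0] with [y]. *)
Lemma pp_dual_tens0 n (phi : pp R n) (c : 'I_n -> N) (a : 'I_n -> M) :
  pp_sol phi M a -> pp_sol (pp_dual phi) N c -> \sum_i tens (c i) (a i) = 0.
Proof.
move=> [y yP] /pp_dualE [z [cE zB]].
transitivity (\sum_i tens (z i) (\sum_j pp_A phi i j *: a j)).
  under eq_bigr => j _ do rewrite cE tens_suml.
  rewrite exchange_big; apply: eq_bigr => i _.
  by rewrite tens_sumr; apply: eq_bigr => j _; rewrite tensZ.
under eq_bigr => i _ do rewrite yP tens_sumr.
rewrite exchange_big big1 // => l _.
under eq_bigr => i _ do rewrite -tensZ.
by rewrite -tens_suml -zB tens0l.
Qed.

(* [g] is a linear relation sum_w w g(w) = 0 between the elements of [N]; finite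
   support is replaced by vanishing on all large enough duplicate-free lists. *)
Definition relation (g : N -> R) : Prop :=
  exists W0 : seq N, forall W, uniq W -> {subset W0 <= W} ->
    \sum_(w <- W) (g w : R^c) *: w = 0.

Let delta (k w : N) : R := (w == k)%:R.

Let sum_delta W k (r : R) : uniq W -> k \in W ->
  \sum_(w <- W) (delta k w * r : R^c) *: w = (r : R^c) *: k.
Proof.
move=> uW kW; rewrite (bigD1_seq k) //= big1 => [|w wk].
  by rewrite /delta eqxx mul1r addr0.
by rewrite /delta (negPf wk) mul0r scale0r.
Qed.

(* [N (x) M] is the quotient of the finitely supported functions [N -> M] by
   the functions of this form. *)
Definition relation_comb (f : N -> M) : Prop :=
  exists q (g : 'I_q -> N -> R) (m : 'I_q -> M),
    (forall l, relation (g l)) /\ forall w, f w = \sum_l g l w *: m l.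

Let relation_comb0 : relation_comb (fun=> 0).
Proof.
exists 0%N, (fun _ _ => 0), (fun=> 0); split; first by case.
by move=> w; rewrite big_ord0.
Qed.

Let relation_combB f f' : relation_comb f -> relation_comb f' ->
  relation_comb (fun w => f w - f' w).
Proof.
move=> [q [g [m [gP fE]]]] [q' [g' [m' [gP' fE']]]].
exists (q + q')%N.
exists (fun l => match fintype.split l with inl i => g i | inr i => g' i end).
exists (fun l => match fintype.split l with inl i => m i | inr i => - m' i end).
split=> [l|w]; first by case: fintype.splitP.
rewrite big_split_ord /= fE fE' -sumrN; congr (_ + _); apply: eq_bigr => i _.
  by rewrite -[lshift _ _]/(unsplit (inl i)) unsplitK.
by rewrite -[rshift _ _]/(unsplit (inr i)) unsplitK scalerN.
Qed.

Let relation_comb1 f (g : N -> R) m : relation g ->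
  (forall w, f w = g w *: m) -> relation_comb f.
Proof.
move=> gP fE; exists 1%N, (fun=> g), (fun=> m); split=> // w.
by rewrite big_ord1.
Qed.

Let P : lmodType R := prodmod (fun _ : N => M).

Let F : tensor_free N M -> zmodule P :=
  fglift (fun km : N * M => (fun w => delta km.1 w *: km.2) : zmodule P).

Let FB : {morph F : x y / x - y}. Proof. exact: lift_is_additive. Qed.

Let F0 : F 0 = 0. Proof. by rewrite -(subrr 0) FB subrr. Qed.

Let FD : {morph F : x y / x + y}.
Proof. by move=> x y; rewrite -[y in LHS]opprK -[- y]sub0r !FB F0 sub0r opprK. Qed.

Let F_pure k m : F (fpure k m) = fun w => delta k w *: m.
Proof. by rewrite /F /fpure liftU scale1r. Qed.

(** The preimage of the combinations under [F] is a subgroup, so generators suffice. Additivity in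
    [k] and balancedness each give one relation in [N]; additivity in [m] gives the zero
    function. *)
Let F_rel x : x \in @tensor_rel R N M -> relation_comb (F x).
Proof.
move=> /asboolP /(_ (fun x => `[< relation_comb (F x) >])).
move=> xP; apply/asboolP/xP => [|_ []].
- split; first by apply/asboolP; rewrite F0.
  by move=> y z /asboolP yP /asboolP zP; apply/asboolP; rewrite FB; exact: relation_combB.
- move=> k k' m; apply/asboolP; rewrite FB FD !F_pure.
  apply: (@relation_comb1 _ (fun w => delta (k + k') w * 1 - (delta k w * 1 + delta k' w * 1)) m).
    (* Coincidences among the three elements do no harm: each [delta] term is summed separately. *)
    exists [:: k + k'; k; k'] => W uW sW.
    under eq_bigr do rewrite scalerBl scalerDl.
    rewrite sumrB big_split !sum_delta ?sW ?inE ?eqxx ?orbT // !scale1r.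
    by rewrite subrr.
  by move=> w; rewrite !mulr1 scalerBl scalerDl.
- move=> k m m'; apply/asboolP; rewrite FB FD !F_pure.
  apply: (@relation_comb1 _ (fun=> 0) 0); last first.
    move=> w; rewrite scaler0.
    by apply/eqP; rewrite subr_eq0 scalerDr.
  by exists [::] => W _ _; rewrite big1 // => w _; rewrite scale0r.
- move=> k r m; apply/asboolP; rewrite FB !F_pure.
  apply: (@relation_comb1 _ (fun w => delta ((r : R^c) *: k) w * 1 - delta k w * r) m).
    exists [:: (r : R^c) *: k; k] => W uW sW.
    under eq_bigr do rewrite scalerBl.
    by rewrite sumrB !sum_delta ?sW ?inE ?eqxx ?orbT // !scale1r subrr.
  by move=> w; rewrite mulr1 scalerBl -scalerA.
Qed.

(* Listing without repetition all elements of [N] involved, as [w_1, ..., w_p],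
   the matrix [A] records which [w_j] equals [c_i], and the columns of [B] are
   the relations occurring in [relation_comb]. *)
Lemma tens0_pp_dual n (c : 'I_n -> N) (a : 'I_n -> M) :
  \sum_i tens (c i) (a i) = 0 ->
  exists phi : pp R n, pp_sol phi M a /\ pp_sol (pp_dual phi) N c.
Proof.
move=> ca0.
have : \sum_i fpure (c i) (a i) \in @tensor_rel R N M.
  rewrite -[X in X \in _]subr0 Quotient.idealrBE raddf_sum raddf0.
  exact/eqP.
move=> /F_rel [q [g [m [gP fE]]]].
have {}fE w : \sum_i delta (c i) w *: a i = \sum_l g l w *: m l.
  rewrite -fE (big_morph F FD F0).
  under [in RHS]eq_bigr do rewrite F_pure.
  by rewrite -[RHS]/(prodmod_proj w (\sum_i _)) raddf_sum.
have [W0 W0P] := choice gP.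
pose W := undup (codom c ++ flatten (codom W0)).
have uW : uniq W by apply: undup_uniq.
have cW i : c i \in W by rewrite mem_undup mem_cat codom_f.
have W0W l : {subset W0 l <= W}.
  move=> w wl; rewrite mem_undup mem_cat; apply/orP; right; apply/flattenP.
  by exists (W0 l); rewrite ?codom_f.
exists (@PP R n (size W) q (\matrix_(j, i) delta (c i) W`_j) (\matrix_(j, l) g l W`_j)).
split.
  exists m => j /=.
  by under eq_bigr do rewrite mxE; rewrite fE; apply: eq_bigr => l _; rewrite mxE.
apply/pp_dualE; exists (fun j : 'I_(size W) => W`_j); split=> i /=.
  have := sum_delta 1 uW (cW i); rewrite scale1r (big_nth 0) big_mkord => <-.
  by apply: eq_bigr => j _; rewrite mxE mulr1.
under eq_bigr do rewrite mxE.
by have := W0P i W uW (W0W i); rewrite (big_nth 0) big_mkord.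
Qed.

End TensSums.

Lemma tensor_map_sum (R : pzRingType) (N N' : rmodType R) (M M' : lmodType R)
    (f : {linear N -> N'}) (g : {linear M -> M'}) (I : Type) (s : seq I)
    (k : I -> N) (m : I -> M) :
  tensor_map f g (\sum_(i <- s) tens (k i) (m i)) = \sum_(i <- s) tens (f (k i)) (g (m i)).
Proof. by rewrite raddf_sum; apply: eq_bigr => i _; exact: tensor_map_tens. Qed.

(** * Products: pp solutions and the Mittag-Leffler condition *)

Section Products.
Variable R : pzRingType.

Lemma pp_sol_linear n (phi : pp R n) (M M' : lmodType R) (f : {linear M -> M'})
    (a : 'I_n -> M) :
  pp_sol phi M a -> pp_sol phi M' (f \o a).
Proof.
move=> [y yP]; exists (f \o y) => i.
have := congr1 f (yP i); rewrite !linear_sum /=.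
under eq_bigr do rewrite linearZ /=.
by under [in RHS]eq_bigr do rewrite linearZ /=.
Qed.

Lemma pp_sol_prod n (phi : pp R n) (I : Type) (N : I -> lmodType R)
    (c : 'I_n -> prodmod N) :
  (forall i, pp_sol phi (N i) (fun j => c j i)) -> pp_sol phi (prodmod N) c.
Proof.
move=> cP; pose y i := sval (cid (cP i)); exists (fun l i => y i l) => e.
apply: functional_extensionality_dep => i.
rewrite -[LHS]/(prodmod_proj i _) -[RHS]/(prodmod_proj i _) !linear_sum.
exact: (svalP (cid (cP i))).
Qed.

(** Solution sets in a product are computed componentwise: projections give one direction, a choice
    of witnesses the other. *)
Lemma definable_closure_prod (X : lmodType R -> Prop) (I : Type)
    (N : I -> lmodType R) :
  (forall i, X (N i)) -> definable_closure X (prodmod N).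
Proof.
move=> XN n phi psi le_phi_psi c cP; apply: pp_sol_prod => i.
by apply: le_phi_psi => //; apply: (pp_sol_linear (prodmod_proj i) cP).
Qed.

End Products.

(* Otherwise every [phi] in the pp type of [a] has a counterexample [c_phi] in
   some [N_phi]; the family of the [c_phi] then gives an element of the tensor
   product with the product of the [N_phi] that vanishes in every component,
   yet not globally. *)
Lemma mittag_leffler_isolated (R : pzRingType) (K : rmodType R -> Prop)
    (M : lmodType R) n (a : 'I_n -> M) :
  mittag_leffler K M ->
  exists phi : pp R n, pp_sol phi M a /\
    forall psi : pp R n, pp_sol psi M a -> pp_le K (pp_dual psi) (pp_dual phi).
Proof.
move=> ML; apply: contrapT => noiso.
have ce (phi : {phi : pp R n | pp_sol phi M a}) :
    exists Nc : {N : rmodType R & 'I_n -> N},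
      [/\ K (tag Nc), \sum_i tens (tagged Nc i) (a i) = 0 &
          ~ pp_sol (pp_dual (sval phi)) (tag Nc) (tagged Nc)].
  case: phi => phi phia /=; apply: contrapT => nce; apply: noiso.
  exists phi; split=> // psi psia N KN c psic; apply: contrapT => nphic.
  apply: nce; exists (Tagged (fun N : rmodType R => 'I_n -> N) c).
  by split=> //; exact: pp_dual_tens0 psia psic.
have [Nc NcP] := choice ce.
pose N phi := tag (Nc phi).
pose c j : prodmod N := fun phi => tagged (Nc phi) j.
have ca0 : \sum_j tens (c j) (a j) = 0.
  apply: (ML _ N) => [phi|]; first by case: (NcP phi).
  apply: functional_extensionality_dep => phi; rewrite /tensor_prod_map.
  rewrite raddf0 tensor_map_sum.
  by case: (NcP phi).
have [phi [phia phic]] := tens0_pp_dual ca0.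
have [_ _] := NcP (exist _ phi phia); apply.
exact: (pp_sol_linear (prodmod_proj (exist _ phi phia)) phic).
Qed.

(** * Submodules spanned by a set *)

Lemma val_lin_comb (R : pzRingType) (M : lmodType R) (S : submodClosed M)
    (I : Type) (s : seq I) (r : I -> R) (x : I -> submod S) :
  val (\sum_(i <- s) r i *: x i) = \sum_(i <- s) r i *: val (x i).
Proof. by rewrite raddf_sum; apply: eq_bigr => i _; exact: GRing.valZ. Qed.

Section LinSpan.
Variables (R : pzRingType) (M : lmodType R) (G : set M).

Definition span_mem : {pred M} := fun x => `[< lin_span G x >].

Lemma span_mem_submod : submod_closed span_mem.
Proof.
split=> [|a x y /asboolP [n [r [g [gG ->]]]] /asboolP [n' [r' [g' [gG' ->]]]]].
  apply/asboolP; exists 0%N, (fun=> 0), (fun=> 0); split; first by case.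
  by rewrite big_ord0.
apply/asboolP; exists (n + n')%N.
exists (fun l => match fintype.split l with inl i => a * r i | inr i => r' i end).
exists (fun l => match fintype.split l with inl i => g i | inr i => g' i end).
split=> [l|]; first by case: fintype.splitP.
rewrite big_split_ord scaler_sumr; congr (_ + _); apply: eq_bigr => i _.
  by rewrite -[lshift _ _]/(unsplit (inl i)) unsplitK scalerA.
by rewrite -[rshift _ _]/(unsplit (inr i)) unsplitK.
Qed.

HB.instance Definition _ :=
  GRing.isSubmodClosed.Build R M span_mem span_mem_submod.

Lemma span_memP x : reflect (lin_span G x) (x \in span_mem).
Proof. exact: asboolP. Qed.

Lemma span_mem_gen x : G x -> x \in span_mem.
Proof.
move=> Gx; apply/span_memP; exists 1%N, (fun=> 1), (fun=> x); split=> //.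
by rewrite big_ord1 scale1r.
Qed.

(** Second factors are expanded in generators and the coefficients moved to the left, so that only
    tuples from [G] need witnesses. *)
Lemma tensor_span (N : rmodType R) (t : tensor N (submod span_mem)) :
  exists s : seq (N * submod span_mem),
    (forall p, p \in s -> G (val p.2)) /\ t = \sum_(p <- s) tens p.1 p.2.
Proof.
have [s ->] := tensorP t.
elim: s => [|[k m] s [s' [s'G s'E]]]; first by exists [::]; rewrite !big_nil.
have /span_memP [n [r [g [gG mE]]]] := valP m.
pose gS i : submod span_mem := Sub (g i) (span_mem_gen (gG i)).
have {}mE : m = \sum_i r i *: gS i.
  by apply: val_inj; rewrite mE val_lin_comb.
exists ([seq ((r i : R^c) *: k, gS i) | i <- index_enum 'I_n] ++ s'); split.
  by move=> p; rewrite mem_cat => /orP[/mapP[i _ ->]|/s'G //]; exact: gG.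
rewrite big_cons big_cat big_map /= -s'E mE tens_sumr; congr (_ + _).
by apply: eq_bigr => i _; rewrite tensZ.
Qed.

End LinSpan.

(** * Countable closures *)

Lemma countable_cover (T : choiceType) (x0 : T) (X : set T) :
  countable X -> exists x : nat -> T, X `<=` range x.
Proof.
move=> /countable_injP [f fi].
exists (fun n => xget x0 [set m | X m /\ f m = n]) => m Xm; exists (f m) => //.
have [] := @xgetPex _ x0 [set m' | X m' /\ f m' = f m]; first by exists m.
by move=> Xm' /fi; apply; apply/mem_set.
Qed.

(* Trees are formal terms for the elements of the closure of the range of [x]:
   a node [i ts] denotes the [i]-th element of [W] at the tuple denoted by [ts]. *)
Fixpoint closure_eval (T : Type) (x0 : T) (x : nat -> T) (W : seq T -> seq T)
    (t : GenTree.tree nat) : T :=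
  match t with
  | GenTree.Leaf n => x n
  | GenTree.Node i ts => nth x0 (W (map (closure_eval x0 x W) ts)) i
  end.

(** There are countably many trees, and a list from the range of the evaluation lifts to a list of
    trees, which become the children of a new node. *)
Lemma countable_closure (T : choiceType) (x0 : T) (X : set T)
    (W : seq T -> seq T) :
  countable X ->
  exists G : set T, [/\ countable G, X `<=` G &
    forall s, (forall y, y \in s -> G y) -> forall i, G (nth x0 (W s) i)].
Proof.
move=> /(countable_cover x0) [x Xx].
exists (range (closure_eval x0 x W)); split.
- exact: sub_countable (card_image_le _ _) (countableP _).
- by move=> _ /Xx [n _ <-]; exists (GenTree.Leaf n).
move=> s sG i.
have [ts <-] : exists ts, map (closure_eval x0 x W) ts = s.
  elim: s sG => [|y s IHs] sG; first by exists [::].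
  have [t _ <-] := sG y (mem_head _ _).
  have [z zs|ts <-] := IHs; first by apply: sG; rewrite inE zs orbT.
  by exists (t :: ts).
by exists (GenTree.Node i ts).
Qed.

Theorem proposition6p4 (R : pzRingType)
    (K : rmodType R -> Prop) (L : lmodType R -> Prop)
    (KL : definably_dual K L)
    (M : lmodType R) (ML : mittag_leffler K M)
    (X : set M) (cX : countable X) :
  exists S : submodClosed M,
    [/\ X `<=` [set` S],
        countably_generated S,
        dual_pure K S &
        mittag_leffler K (submod S)].
Proof.
(* Tuples are taken as lists, so that one choice of formulas and witnesses covers all lengths. *)
have iso (s : seq M) := mittag_leffler_isolated (fun i : 'I_(size s) => s`_i) ML.
pose phi s := sval (cid (iso s)).
have phiM s : pp_sol (phi s) M (fun i => s`_i) by case: (svalP (cid (iso s))).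
have phiK s psi : pp_sol psi M (fun i => s`_i) ->
    pp_le K (pp_dual psi) (pp_dual (phi s)).
  by case: (svalP (cid (iso s))) => _; apply.
pose w s := sval (cid (phiM s)).
have [G [cG XG GW]] := countable_closure 0 (fun s => codom (w s)) cX.
pose S : submodClosed M := span_mem G.
have pureS : dual_pure K S.
  move=> C CK; apply: raddf_inj => t t0.
  have [s [sG tE]] := tensor_span t.
  pose sM := [seq val p.2 | p <- s].
  pose c (i : 'I_(size sM)) := (s`_i).1.
  pose h (i : 'I_(size sM)) := (s`_i).2.
  have hE i : val (h i) = sM`_i.
    rewrite /sM (nth_map 0) //.
    by rewrite -(size_map (fun p => val p.2)).
  have {}tE : t = \sum_i tens (c i) (h i).
    rewrite tE (big_nth 0) big_mkord.
    by rewrite -(size_map (fun p => val p.2)).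
  have ct0 : \sum_i tens (c i) ((val \o h) i) = 0.
    by rewrite -[RHS]t0 tE; symmetry; exact: tensor_map_sum.
  have [psi [psiM psiC]] := tens0_pp_dual ct0.
  rewrite (funext hE : val \o h = _) in psiM.
  rewrite tE; apply: (@pp_dual_tens0 _ _ _ _ (phi sM)); last first.
    (* The inequality of dual formulas over [K] passes to [C] in the definable closure. *)
    exact: CK (phiK _ _ psiM) _ psiC.
  (* The witnesses of [phi sM] in [M] lie in [G], so [phi sM] already holds of [h] in [S]. *)
  have wG l : w sM l \in S.
    apply: span_mem_gen.
    have := GW sM _ (enum_rank l).
    rewrite (nth_map l) ?nth_enum_rank -?cardE //; apply.
    by move=> _ /mapP[p /sG pG ->].
  exists (fun l => Sub (w sM l) (wG l)) => e; apply: val_inj.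
  rewrite !val_lin_comb.
  rewrite -(svalP (cid (phiM sM)) e) -/(w sM).
  by apply: eq_bigr => j _; rewrite hE.
exists S; split=> //.
- by move=> x /XG /span_mem_gen.
- by exists G => //; apply/seteqP; split=> x /span_memP.
(* By purity, tensoring with the product of the [N i] embeds [S] into [M], where injectivity is
   known. *)
move=> I N KN t t' tt'.
apply: (pureS _ (definable_closure_prod KN)); apply: (ML _ N KN).
apply: functional_extensionality_dep => i.
have := congr1 (tensor_map idfun (val : submod S -> M)) (congr1 (@^~ i) tt').
have mapC u : tensor_map idfun (val : submod S -> M) (tensor_prod_map u i) =
    tensor_prod_map (tensor_map (idfun : prodmod N -> prodmod N) (val : submod S -> M) u) i.
  have [s ->] := tensorP u.
  by rewrite /tensor_prod_map !tensor_map_sum.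
by rewrite !mapC.
Qed.
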